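(* Let $R$ be an Abelian exchange ring and let $G$ be a locally finite group. Then the group ring $RG$ has stable range one.
   Context: All rings are associative with identity, not necessarily commutative. For a ring $R$ and a group $G$, $RG$ denotes the group ring of $G$ over $R$. A group is locally finite if each of its finitely generated subgroups is finite. A ring is Abelian if all its idempotents are central. A ring $R$ is an exchange ring if for every $a\in R$ there is an idempotent $e\in aR$ with $1-e\in (1-a)R$ (equivalently, the module $R_R$ has the finite exchange property). A ring $T$ has stable range one if for all $a,b\in T$ with $aT+bT=T$ there exists $x\in T$ such that $a+bx$ is a unit of $T$. *)

(* Defs.v *)
From HB Require Import structures.
From mathcomp Require Import all_boot all_order all_algebra.
From mathcomp Require Import finmap.
From mathcomp Require Import boolp classical_sets cardinality.
From mathcomp.multinomials Require Import monalg.

Set Implicit Arguments.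
Unset Strict Implicit.
Unset Printing Implicit Defensive.

Import GRing.Theory.
Local Open Scope fset_scope.
Local Open Scope ring_scope.

(* The carrier is multinomials' type of finitely supported functions G -> R;
   the alias is needed because the ring structure that multinomials puts on
   {malg R[K]} is restricted to monoids K without nontrivial units. *)
Definition group_ring (R : pzRingType) (G : groupType) : Type := {malg R[G]}.

HB.instance Definition _ (R : pzRingType) (G : groupType) :=
  GRing.Zmodule.on (group_ring R G).

Section GroupRing.
Context (R : pzRingType) (G : groupType).
Implicit Types (x y z : {malg R[G]}) (a b : R) (g h : G).

Definition group_ring_one : group_ring R G := << (1 : R) *g (1%g : G) >>.

Definition group_ring_mul (x y : group_ring R G) : group_ring R G :=
  \sum_(g <- msupp x) \sum_(h <- msupp y) << x@_g * y@_h *g (g * h)%g >>.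

Local Notation mul := group_ring_mul.

Lemma group_ring_mulw (d1 d2 : {fset G}) x y :
  msupp x `<=` d1 -> msupp y `<=` d2 ->
  mul x y = \sum_(g <- d1) \sum_(h <- d2) << x@_g * y@_h *g (g * h)%g >>.
Proof.
move=> le_d1 le_d2; rewrite /mul (big_fset_incl _ le_d1) /=.
  apply/eq_bigr => g _; apply/big_fset_incl => // h _ /mcoeff_outdom ->.
  by rewrite mulr0 monalgU0.
move=> g _ /mcoeff_outdom xg0.
by rewrite big1 // => h _; rewrite xg0 mul0r monalgU0.
Qed.

Lemma group_ring_mulUU a b g h :
  mul << a *g g >> << b *g h >> = << a * b *g (g * h)%g >>.
Proof.
by rewrite (group_ring_mulw msuppU_le msuppU_le) !big_seq_fset1 !mcoeffUU.
Qed.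

Lemma group_ring_mulDl : left_distributive mul +%R.
Proof.
move=> x y z; have sz := fsubset_refl (msupp z).
rewrite (group_ring_mulw (msuppD_le x y) sz).
rewrite (group_ring_mulw (fsubsetUl (msupp x) (msupp y)) sz).
rewrite (group_ring_mulw (fsubsetUr (msupp x) (msupp y)) sz).
rewrite -big_split /=; apply/eq_bigr => g _.
rewrite -big_split /=; apply/eq_bigr => h _.
by rewrite mcoeffD mulrDl monalgUD.
Qed.

Lemma group_ring_mulDr : right_distributive mul +%R.
Proof.
move=> z x y; have sz := fsubset_refl (msupp z).
rewrite (group_ring_mulw sz (msuppD_le x y)).
rewrite (group_ring_mulw sz (fsubsetUl (msupp x) (msupp y))).
rewrite (group_ring_mulw sz (fsubsetUr (msupp x) (msupp y))).
rewrite -big_split /=; apply/eq_bigr => g _.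
rewrite -big_split /=; apply/eq_bigr => h _.
by rewrite mcoeffD mulrDr monalgUD.
Qed.

Lemma group_ring_mul0r : left_zero 0 mul.
Proof.
by move=> x; apply: (addrI (mul 0 x)); rewrite -group_ring_mulDl !addr0.
Qed.

Lemma group_ring_mulr0 : right_zero 0 mul.
Proof.
by move=> x; apply: (addrI (mul x 0)); rewrite -group_ring_mulDr !addr0.
Qed.

Lemma group_ring_mul_suml (I : Type) (r : seq I) (F : I -> group_ring R G) x :
  mul (\sum_(i <- r) F i) x = \sum_(i <- r) mul (F i) x.
Proof.
exact: (big_morph (mul^~ x) (fun _ _ => group_ring_mulDl _ _ _)
         (group_ring_mul0r _)).
Qed.

Lemma group_ring_mul_sumr (I : Type) (r : seq I) (F : I -> group_ring R G) x :
  mul x (\sum_(i <- r) F i) = \sum_(i <- r) mul x (F i).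
Proof.
exact: (big_morph (mul x) (fun _ _ => group_ring_mulDr _ _ _)
         (group_ring_mulr0 _)).
Qed.

Lemma group_ring_mulA : associative mul.
Proof.
suff sumA (d1 d2 d3 : seq G) (a1 a2 a3 : G -> R) :
    let s (d : seq G) (a : G -> R) : group_ring R G :=
      \sum_(g <- d) << a g *g g >> in
    mul (s d1 a1) (mul (s d2 a2) (s d3 a3))
      = mul (mul (s d1 a1) (s d2 a2)) (s d3 a3).
  move=> x y z; have := sumA (msupp x) (msupp y) (msupp z)
    (fun g => x@_g) (fun g => y@_g) (fun g => z@_g).
  by rewrite /= -!monalgE.
move=> s; rewrite {}/s.
rewrite [LHS](group_ring_mul_suml d1) (group_ring_mul_suml d1).
rewrite [RHS](group_ring_mul_suml d1).
apply: eq_bigr => g _.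
rewrite (group_ring_mul_suml d2) (group_ring_mul_sumr d2).
rewrite (group_ring_mul_sumr d2) (group_ring_mul_suml d2).
apply: eq_bigr => h _.
rewrite (group_ring_mul_sumr d3) (group_ring_mul_sumr d3).
rewrite group_ring_mulUU (group_ring_mul_sumr d3).
apply: eq_bigr => k _.
by rewrite !group_ring_mulUU mulrA mulgA.
Qed.

Lemma group_ring_mul1r : left_id group_ring_one mul.
Proof.
move=> x; rewrite [x in LHS]monalgE group_ring_mul_sumr [RHS]monalgE.
by apply: eq_bigr => g _; rewrite group_ring_mulUU mul1r mul1g.
Qed.

Lemma group_ring_mulr1 : right_id group_ring_one mul.
Proof.
move=> x; rewrite [x in LHS]monalgE group_ring_mul_suml [RHS]monalgE.
by apply: eq_bigr => g _; rewrite group_ring_mulUU mulr1 mulg1.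
Qed.

HB.instance Definition _ := GRing.Zmodule_isPzRing.Build (group_ring R G)
  group_ring_mulA group_ring_mul1r group_ring_mulr1
  group_ring_mulDl group_ring_mulDr.

End GroupRing.

Section RingProperties.
Context (T : pzRingType).

Definition idempotent_elt (e : T) : Prop := e * e = e.

(* Abelian in the sense that idempotents are central: T need not be
   commutative. *)
Definition abelian_ring : Prop :=
  forall e : T, idempotent_elt e -> forall x : T, e * x = x * e.

Definition right_ideal_of (a : T) : set T := [set a * r | r in [set: T]]%classic.

Definition exchange_ring : Prop :=
  forall a : T, exists e : T,
    [/\ idempotent_elt e, right_ideal_of a e & right_ideal_of (1 - a) (1 - e)].

(* GRing.unit is only available on rings with a computable inverse. *)
Definition is_unit (x : T) : Prop := exists y : T, x * y = 1 /\ y * x = 1.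

Definition stable_range_one : Prop :=
  forall a b : T,
    [set u + v | u in right_ideal_of a & v in right_ideal_of b]%classic
      = [set: T]%classic ->
    exists x : T, is_unit (a + b * x).

End RingProperties.

Section GroupProperties.
Context (G : groupType).

Definition is_subgroup (H : set G) : Prop :=
  [/\ H 1%g, (forall x y : G, H x -> H y -> H (x * y)%g)
    & forall x : G, H x -> H (x^-1)%g].

Definition generated_subgroup (S : set G) : set G := smallest is_subgroup S.

Definition locally_finite : Prop :=
  forall S : set G, finite_set S -> finite_set (generated_subgroup S).

End GroupProperties.

Arguments abelian_ring : clear implicits.
Arguments exchange_ring : clear implicits.
Arguments stable_range_one : clear implicits.
Arguments locally_finite : clear implicits.

(* Main.v *)
From HB Require Import structures.
Require Import Defs.
From mathcomp Require Import all_boot all_order all_algebra.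
From mathcomp Require Import finmap.
From mathcomp Require Import boolp classical_sets cardinality.
From mathcomp.multinomials Require Import monalg.

(** The elements of a Bezout relation [a c + b d = 1] in [RG] involve finitely
    many elements of [G], hence live in [RH] for a finite subgroup [H]; there
    one has to find a unit in [a + b RH].  The ring [T = RH] is generated, as a
    module over [R], by finitely many elements that commute with [R], and this
    is all that is used of it
    ([finite_centralizing_extension_stable_range_one]).

    Idempotents of [R] are central in [R] and in [T], so solutions of
    [(a + b x) y = 1] that exist over finitely many orthogonal idempotents with
    sum [1] can be glued.  By compactness of the Stone space of the Boolean
    algebra of idempotents ([idem_compactness]) it is enough to find a solution
    near each of its points, that is, for each ultrafilter [F] of idempotents,
    over some [e] in [F].  The exchange property makes the stalk of [R] at [F]
    a local ring: [r] or [1 - r] is invertible over an idempotent of [F]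
    ([stalk_unit_or]).  Let [P] be the ideal of all [r] that are not invertible
    in the stalk.  Then [R / P] is a division ring, [T / TP] is finite
    dimensional over it, and so [T / TP] has finite length
    ([rank_strict]).  A ring of finite length has stable range one, by Bass's
    theorem ([right_stable_range_mod]), so the equation can be solved modulo
    [TP]; Nakayama's lemma over the local stalk ([nakayama]) turns this into a
    solution in the stalk, and that one is already valid over some [e] in [F].

    All of this only produces right inverses.  That is enough: applied a second
    time, the one-sided property makes one-sided inverses two-sided
    ([stable_range_one_right]).

    Stalks and residue rings never appear as types.  Statements about the stalk
    at [F] are statements that hold after multiplication by some [e] in [F],
    and statements about [T / W] are about right ideals of [T] that contain
    [W]. *)

Set Implicit Arguments.
Unset Strict Implicit.
Unset Printing Implicit Defensive.

Import GRing.Theory.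
Local Open Scope ring_scope.
Local Open Scope classical_set_scope.

(** * Rings of finite length have stable range one *)

Section RightIdeals.
Variable T : pzRingType.
Implicit Types (a b x y : T) (N M : set T).

Definition right_ideal N : Prop :=
  [/\ N 0, forall x y, N x -> N y -> N (x + y)
    & forall x y, N x -> N (x * y)].

Section Closure.
Variables (N : set T) (idN : right_ideal N).

Lemma right_ideal0 : N 0. Proof. by case: idN. Qed.

Lemma right_idealD x y : N x -> N y -> N (x + y).
Proof. by case: idN => _ + _; apply. Qed.

Lemma right_idealMr x y : N x -> N (x * y).
Proof. by case: idN => _ _; apply. Qed.

Lemma right_idealN x : N x -> N (- x).
Proof. by rewrite -mulrN1; apply: right_idealMr. Qed.

Lemma right_idealB x y : N x -> N y -> N (x - y).
Proof. by move=> Nx /right_idealN; apply: right_idealD. Qed.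

End Closure.

Definition principal_plus a N : set T := [set t | exists y, N (t - a * y)].

Lemma principal_plus_ideal a N :
  right_ideal N -> right_ideal (principal_plus a N).
Proof.
move=> idN; split.
- by exists 0; rewrite mulr0 subr0; apply: right_ideal0.
- move=> x y [u Nu] [v Nv]; exists (u + v).
  by rewrite mulrDr opprD addrACA; apply: right_idealD.
- move=> x y [u Nu]; exists (u * y).
  by rewrite mulrA -mulrBl; apply: right_idealMr.
Qed.

Lemma sub_principal_plus a N : N `<=` principal_plus a N.
Proof. by move=> x Nx; exists 0; rewrite mulr0 subr0. Qed.

Lemma principal_plus_gen a N : right_ideal N -> principal_plus a N a.
Proof. by move=> idN; exists 1; rewrite mulr1 subrr; apply: right_ideal0. Qed.

Lemma principal_plus_min a N M :
  right_ideal M -> N `<=` M -> M a -> principal_plus a N `<=` M.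
Proof.
move=> idM sNM Ma x [y /sNM My].
by rewrite -[x](subrK (a * y)); apply: right_idealD => //; apply: right_idealMr.
Qed.

Lemma preim_mull_ideal a N : right_ideal N -> right_ideal [set t | N (a * t)].
Proof.
move=> idN; split=> [|x y /= Nx Ny|x y /= Nx] /=.
- by rewrite mulr0; apply: right_ideal0.
- by rewrite mulrDr; apply: right_idealD.
- by rewrite mulrA; apply: right_idealMr.
Qed.

Lemma setI_ideal N M : right_ideal N -> right_ideal M -> right_ideal (N `&` M).
Proof.
move=> idN idM; split.
- by split; apply: right_ideal0.
- by move=> x y [? ?] [? ?]; split; apply: right_idealD.
- by move=> x y [? ?]; split; apply: right_idealMr.
Qed.

Lemma setT_ideal : right_ideal setT. Proof. by split. Qed.

Variable W : set T.

(** The right module [T / W] has finite length, expressed by a function [l] that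
    strictly increases along proper inclusions: minimal elements exist because
    lengths are natural numbers, and maximal elements because the length of [T]
    bounds all the others. *)
Definition finite_length_over : Prop :=
  exists l : set T -> nat, forall N M,
    right_ideal N -> right_ideal M -> W `<=` N -> N `<=` M ->
    (l M <= l N)%N -> M `<=` N.

Definition maximal_over M : Prop :=
  [/\ right_ideal M, W `<=` M, ~ M 1
    & forall N, right_ideal N -> M `<=` N -> ~ N 1 -> N `<=` M].

(** The preimage in [T] of the Jacobson radical of [T / W]. *)
Definition radical_over : set T := [set x | forall M, maximal_over M -> M x].

Hypothesis W_ideal : right_ideal W.
Hypothesis W_mull : forall a x, W x -> W (a * x).
Hypothesis W_length : finite_length_over.

Lemma exists_minimal (C : set (set T)) :
    (forall N, C N -> right_ideal N /\ W `<=` N) -> (exists N, C N) ->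
  exists2 N, C N & forall M, C M -> M `<=` N -> N `<=` M.
Proof.
case: W_length => l l_strict C_ideal [N0 CN0].
have exC : exists n, `[< exists2 N, C N & l N = n >].
  by exists (l N0); apply/asboolP; exists N0.
case: (ex_minnP exC) => n /asboolP[N CN <-] minN; exists N => // M CM sMN.
apply: l_strict => //; try by [case: (C_ideal _ CM) | case: (C_ideal _ CN)].
by apply: minN; apply/asboolP; exists M.
Qed.

Lemma exists_maximal (C : set (set T)) :
    (forall N, C N -> right_ideal N /\ W `<=` N) -> (exists N, C N) ->
  exists2 N, C N & forall M, C M -> N `<=` M -> M `<=` N.
Proof.
case: W_length => l l_strict C_ideal [N0 CN0].
have exC : exists n, `[< exists2 N, C N & l N = n >].
  by exists (l N0); apply/asboolP; exists N0.
have ubC n : `[< exists2 N, C N & l N = n >] -> (n <= l setT)%N.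
  case/asboolP=> N /C_ideal[idN sWN] <-; rewrite leqNgt; apply/negP => ltN.
  have := l_strict _ _ idN setT_ideal sWN (@subsetT _ _) (ltnW ltN).
  by move/(conj (@subsetT _ N))/seteqP=> eqN; rewrite eqN ltnn in ltN.
case: (ex_maxnP exC ubC) => n /asboolP[N CN <-] maxN; exists N => // M CM sNM.
have [[idN sWN] [idM _]] := (C_ideal _ CN, C_ideal _ CM).
by apply: l_strict => //; apply: maxN; apply/asboolP; exists M.
Qed.

Lemma exists_maximal_over N :
    right_ideal N -> W `<=` N -> ~ N 1 ->
  exists2 M, maximal_over M & N `<=` M.
Proof.
move=> idN sWN N1.
have [||M [idM sNM M1] maxM] := @exists_maximal
    [set M | [/\ right_ideal M, N `<=` M & ~ M 1]].
- by move=> M [idM sNM _]; split=> //; apply: subset_trans sNM.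
- by exists N; split.
exists M => //; split=> //; first exact: subset_trans sNM.
move=> L idL sML L1; apply: maxM => //; split=> //.
exact: subset_trans sML.
Qed.

Lemma maximal_over_coprime M a :
  maximal_over M -> ~ M a -> exists y, M (1 - a * y).
Proof.
case=> idM _ _ maxM Ma; apply: contrapT => no_y; apply: Ma.
by apply: maxM (principal_plus_gen a idM); [apply: principal_plus_ideal
  | apply: sub_principal_plus |].
Qed.

Lemma sub_radical : W `<=` radical_over.
Proof. by move=> x Wx M [_ sWM _ _]; apply: sWM. Qed.

Lemma radical_ideal : right_ideal radical_over.
Proof.
split=> [M [idM _ _ _]|x y Jx Jy M maxM|x y Jx M maxM].
- exact: right_ideal0.
- by have [idM _ _ _] := maxM; apply: right_idealD; [|apply: Jx|apply: Jy].
- by have [idM _ _ _] := maxM; apply: right_idealMr; [|apply: Jx].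
Qed.

(** Left multiplication by [a] pulls back a maximal right ideal [M] to a maximal
    right ideal, or to [T] when [a] is in [M]. *)
Lemma radical_mull a x : radical_over x -> radical_over (a * x).
Proof.
move=> Jx M maxM; have [idM sWM M1 _] := maxM.
have [Ma|nMa] := pselect (M a); first exact: right_idealMr.
apply: (Jx [set t | M (a * t)]); split=> /=.
- exact: preim_mull_ideal.
- by move=> t Wt; apply/sWM/W_mull.
- by rewrite mulr1.
move=> N idN sMN N1 s Ns /=; apply: contrapT => nMas; apply: N1.
have [y My] := maximal_over_coprime maxM nMas.
rewrite -[1](subrK (s * (y * a))); apply: right_idealD => //.
  by apply: sMN => /=; rewrite mulrBr mulr1 -[X in M (X - _)]mul1r !mulrA;
    rewrite -mulrBl; apply: right_idealMr.
exact: right_idealMr.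
Qed.

(** If [1 = n + c] splits [T] modulo the radical as the direct sum of [N] and
    [C], then left multiplication by [n] is the projection onto [N] and kills
    [C]. *)
Lemma split_proj (N C : set T) n c x :
    right_ideal N -> right_ideal C -> N `&` C `<=` radical_over ->
  n + c = 1 -> N n -> C c -> C x -> radical_over (n * x).
Proof.
move=> idN idC sNCJ nc1 Nn Cc Cx; apply: sNCJ; split.
  exact: right_idealMr.
have -> : n * x = x - c * x by rewrite -[x in x - _]mul1r -nc1 mulrDl addrK.
by apply: right_idealB => //; apply: right_idealMr.
Qed.

(** Semisimplicity of [T] modulo its radical.  A right ideal [C] that is minimal
    among those with [N + C = T] meets [N] inside every maximal right ideal [M]:
    otherwise [C `&` M] would still be a supplement of [N], and a smaller
    one. *)
Lemma exists_complement N B :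
    right_ideal N -> right_ideal B ->
    radical_over `<=` N -> radical_over `<=` B ->
    (exists2 n, N n & B (1 - n)) ->
  exists C, [/\ right_ideal C, radical_over `<=` C, C `<=` B,
    N `&` C `<=` radical_over & exists2 n, N n & C (1 - n)].
Proof.
move=> idN idB sJN sJB NB1.
have [||C [idC sJC sCB [n Nn Cn]] minC] := @exists_minimal
    [set C | [/\ right_ideal C, radical_over `<=` C, C `<=` B
      & exists2 n, N n & C (1 - n)]].
- move=> C [idC sJC _ _]; split=> //.
  by apply: subset_trans sJC; apply: sub_radical.
- by exists B; split.
exists C; split=> //; last by exists n.
move=> x [Nx Cx] M maxM; have [idM sWM M1 _] := maxM.
apply: contrapT => nMx; have [y My] := maximal_over_coprime maxM nMx.
suff sCM : C `<=` C `&` M by case: (sCM x Cx).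
apply: minC (@subIsetl _ _ _); split.
- exact: setI_ideal.
- by move=> z Jz; split; [apply: sJC | apply: Jz].
- by apply: subset_trans sCB; apply: subIsetl.
exists (n + x * y * (1 - n)).
  by apply: right_idealD => //; do 2!apply: right_idealMr => //.
have -> : 1 - (n + x * y * (1 - n)) = (1 - x * y) * (1 - n).
  by rewrite opprD addrA mulrBl mul1r.
split; last exact: right_idealMr.
rewrite mulrBl mul1r; apply: right_idealB => //.
by do 2!apply: right_idealMr => //.
Qed.

(** Fitting's argument: the descending sequence of the images [a ^+ k I]
    stabilizes, and injectivity then cancels [a ^+ k]. *)
Lemma injective_mod_radical_surj a (I : set T) :
    right_ideal I -> radical_over `<=` I -> (forall x, I x -> I (a * x)) ->
    (forall x, I x -> radical_over (a * x) -> radical_over x) ->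
  forall x, I x -> exists2 y, I y & radical_over (x - a * y).
Proof.
move=> idI sJI aI a_inj.
pose image k : set T := [set x | exists2 y, I y & radical_over (x - a ^+ k * y)].
have [||N [k defN] minN] := @exists_minimal [set N | exists k, N = image k].
- move=> _ [k ->]; split; last first.
    move=> x /sub_radical Jx; exists 0; first exact: right_ideal0.
    by rewrite mulr0 subr0.
  split.
  + exists 0; first exact: right_ideal0.
    by rewrite mulr0 subr0; apply: right_ideal0 radical_ideal.
  + move=> x y [u Iu Ju] [v Iv Jv]; exists (u + v); first exact: right_idealD.
    by rewrite mulrDr opprD addrACA; apply: right_idealD radical_ideal _ _ _ _.
  + move=> x y [u Iu Ju]; exists (u * y); first exact: right_idealMr.
    by rewrite mulrA -mulrBl; apply: right_idealMr radical_ideal _ _ _.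
- by exists (image 0%N); exists 0%N.
have stable : image k `<=` image k.+1.
  rewrite -defN; apply: minN; first by exists k.+1.
  rewrite defN => x [y Iy Jy]; exists (a * y); first exact: aI.
  by rewrite mulrA -exprSr.
have aX_inj m x : I x -> radical_over (a ^+ m * x) -> radical_over x.
  elim: m x => [|m IHm] x Ix; first by rewrite mul1r.
  rewrite exprSr -mulrA => /(IHm _ (aI _ Ix)); exact: a_inj.
move=> x Ix; have [|y Iy Jy] := stable (a ^+ k * x).
  by exists x => //; rewrite subrr; apply: right_ideal0 radical_ideal.
exists y => //; apply: (aX_inj k).
  by apply: right_idealB => //; apply: aI.
by rewrite mulrBr mulrA -exprSr.
Qed.

(** Bass's theorem for [T / W].  Let [J] be the radical, choose [x] such that
    [N = (a + b x) T + J] is maximal, and write [a'] for [a + b x].  Let [C] be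
    a complement of [N] inside [b T + J], and [K] the kernel of [a'] modulo [J].
    If some product of [C] by [K] is not in [J], there is an element of [C] that
    kills a complement of [K] but not [K],
    modulo [J]; it can be taken in [b T], and adding it to [a']
    enlarges the image, a contradiction.  Otherwise [C] is
    contained in the two-sided ideal [I] of all [t] with [t T K] in [J].  As [T]
    modulo [J] is semiprime, [I] meets [K] trivially, so [a'] is injective on
    [I], hence surjective; thus [C] is in [N], which forces [N = T]. *)
Theorem right_stable_range_mod a b c d :
  W (a * c + b * d - 1) -> exists x y, W ((a + b * x) * y - 1).
Proof.
move=> W1; have idJ := radical_ideal; have [J0 JD JM] := radical_ideal.
pose im t := principal_plus t radical_over.
have im_id t : right_ideal (im t) by apply: principal_plus_ideal.
have sJim t : radical_over `<=` im t by apply: sub_principal_plus.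
have [||_ [x ->] maxx] := @exists_maximal [set N | exists x, N = im (a + b * x)].
- move=> _ [x ->]; split=> //.
  by apply: subset_trans (@sub_radical) _; apply: sJim.
- by exists (im (a + b * 0)); exists 0.
exists x; have [a' a'E] : exists a', a' = a + b * x by exists (a + b * x).
rewrite -a'E in maxx *.
have [C [idC sJC sCb sNCJ [n Nn Cn]]] :
    exists C, [/\ right_ideal C, radical_over `<=` C, C `<=` im b,
      im a' `&` C `<=` radical_over & exists2 n, im a' n & C (1 - n)].
  apply: exists_complement => //; exists (a' * c).
    by apply/(right_idealMr (im_id _))/principal_plus_gen.
  exists (d - x * c); rewrite a'E mulrDl mulrBr !mulrA -addrA -opprD.
  rewrite addrACA subrr addr0.
  by rewrite -opprB; apply: (right_idealN idJ); apply: sub_radical; exact: W1.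
pose K := [set t | radical_over (a' * t)].
have idK : right_ideal K by apply: preim_mull_ideal.
have sJK : radical_over `<=` K by move=> t Jt; apply: radical_mull.
have [K' [idK' _ _ sKK'J [h Kh K'h']]] :
    exists K', [/\ right_ideal K', radical_over `<=` K', K' `<=` setT,
      K `&` K' `<=` radical_over & exists2 h, K h & K' (1 - h)].
  apply: exists_complement => //.
  by exists 0 => //; apply: right_ideal0.
(* A proper right ideal containing [a' T + W] would lie in a maximal one, and
   that one contains [J]: right inverses lift from [J] to [W]. *)
suff im1 : im a' 1.
  suff [y Wy] : principal_plus a' W 1.
    by exists y; rewrite -opprB; apply: right_idealN.
  apply: contrapT => no_y.
  have [||//|M maxM sM] := @exists_maximal_over (principal_plus a' W).
  - exact: principal_plus_ideal.
  - exact: sub_principal_plus.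
  have [idM _ M1 _] := maxM; apply: M1; apply: principal_plus_min (im1) => //.
    by move=> t /(_ M maxM).
  exact/sM/principal_plus_gen.
suff sCN : C `<=` im a'.
  by rewrite -[1](subrK n); apply: (right_idealD (im_id _)) => //; apply: sCN.
have [[c0 [k [Cc0 Kk nJ]]]|CK_J] :=
    pselect (exists c0 k, [/\ C c0, K k & ~ radical_over (c0 * k)]).
  (* [c0 h] kills [K'] modulo [J] because [h] projects onto [K] along [K']. *)
  exfalso; apply: nJ; set h' := 1 - h in K'h'.
  have Cch : C (c0 * h) by apply: right_idealMr.
  have Jh'k : radical_over (h' * k).
    apply: (split_proj idK' idK _ _ K'h' Kh Kk); last exact: subrK.
    by rewrite setIC.
  have Jhh' : radical_over (h * h').
    by apply: (split_proj idK idK' sKK'J _ Kh K'h' K'h'); rewrite subrKC.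
  have [z Jz] := sCb _ Cch.
  have im'a' : im (a' + b * z) a'.
    exists h'; have -> : a' - (a' + b * z) * h' =
        a' * h + (c0 * h - b * z) * h' - c0 * (h * h').
      have {1}-> : a' = a' * h + a' * h' by rewrite -mulrDr subrKC mulr1.
      rewrite (mulrDl a') opprD addrA addrK.
      by rewrite mulrBl addrA mulrA addrAC addrK.
    apply: (right_idealB idJ); last exact: radical_mull.
    by apply: JD => //; apply: JM.
  have sim : im a' `<=` im (a' + b * z) by apply: principal_plus_min.
  have im'c : im (a' + b * z) (c0 * h).
    rewrite -[c0 * h](subrK (b * z)).
    apply: (right_idealD (im_id _)); first exact: sJim.
    suff : im (a' + b * z) (a' + b * z - a') by rewrite addrAC subrr add0r.
    by apply: (right_idealB (im_id _)) => //; apply: principal_plus_gen.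
  have Jch : radical_over (c0 * h).
    apply: sNCJ; split=> //; apply: maxx sim _ im'c; exists (x + z).
    by rewrite mulrDr addrA a'E.
  have -> : c0 * k = c0 * h * k + c0 * (h' * k).
    by rewrite mulrA -mulrDl -mulrDr subrKC mulr1.
  by apply: JD; [apply: JM | apply: radical_mull].
pose I := [set t | forall s k, K k -> radical_over (t * s * k)].
have idI : right_ideal I.
  split=> [s k _|t u It Iu s k Kk|t u It s k Kk].
  - by rewrite !mul0r.
  - by rewrite !mulrDl; apply: JD; [apply: It | apply: Iu].
  - by rewrite -(mulrA t); apply: It.
have sCI : C `<=` I.
  move=> t Ct s k Kk; apply: contrapT => nJ; apply: CK_J.
  by exists (t * s), k; split=> //; apply: right_idealMr.
have sJI : radical_over `<=` I by move=> t Jt s k _; exact: JM (JM _ _ Jt).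
have sIKJ : I `&` K `<=` radical_over.
  (* [(I `&` K)^2 <= I K <= J], and [I `&` K] is a direct summand, so that it is
     generated by an idempotent modulo [J]. *)
  have idIK := setI_ideal idI idK.
  have [V [idV _ _ sV [v [Iv Kv] Vv]]] :
      exists V, [/\ right_ideal V, radical_over `<=` V, V `<=` setT,
        (I `&` K) `&` V `<=` radical_over & exists2 v, (I `&` K) v & V (1 - v)].
    apply: exists_complement => //; last first.
      by exists 0 => //; apply: right_ideal0 idIK.
    by move=> t Jt; split; [apply: sJI | apply: sJK].
  move=> t [It Kt]; rewrite -[t]mul1r -(subrKC v 1) mulrDl; apply: JD.
    by rewrite -[v]mulr1; apply: Iv.
  rewrite setIC in sV.
  exact: (split_proj idV idIK sV (subrK v 1) Vv (conj Iv Kv) (conj It Kt)).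
move=> t Ct.
have [||y Iy Jy] := @injective_mod_radical_surj a' I idI sJI _ _ t (sCI t Ct).
- by move=> s Is u k Kk; rewrite -!mulrA !(mulrA s); apply: radical_mull; apply: Is.
- by move=> s Is Js; apply: sIKJ.
- by exists y.
Qed.
End RightIdeals.

(** * Ultrafilters of central idempotents *)

Section Idempotents.
Variable R : pzRingType.
Hypothesis R_abelian : abelian_ring R.
Implicit Types (e f r s : R) (F : set R).

Lemma idem1 : @idempotent_elt R 1. Proof. exact: mulr1. Qed.

Lemma idemB1 e : idempotent_elt e -> idempotent_elt (1 - e).
Proof.
move=> ee; rewrite /idempotent_elt mulrBl mul1r mulrBr mulr1 ee.
by rewrite subrr subr0.
Qed.

Lemma idemM e f :
  idempotent_elt e -> idempotent_elt f -> idempotent_elt (e * f).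
Proof.
move=> ee ff; rewrite /idempotent_elt -mulrA [f * _]mulrA.
by rewrite -(R_abelian ee) -!mulrA ff mulrA ee.
Qed.

(** A proper filter of the Boolean algebra of idempotents, where [e <= f] means
    [e * f = e]. *)
Definition idem_filter F : Prop :=
  [/\ F `<=` @idempotent_elt R, F 1, ~ F 0, forall e f, F e -> F f -> F (e * f)
    & forall e f, F e -> idempotent_elt f -> e * f = e -> F f].

Definition idem_ultrafilter F : Prop :=
  idem_filter F /\ forall e, idempotent_elt e -> F e \/ F (1 - e).

Lemma idem_filter_ultra F0 :
  idem_filter F0 -> exists2 F, idem_ultrafilter F & F0 `<=` F.
Proof.
move=> filF0.
(* The empty set is admitted because the union of the empty chain is empty. *)
have [] := @Zorn_bigcup _ [set F | F = set0 \/ (idem_filter F /\ F0 `<=` F)].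
  move=> C CP totC.
  have [[F [CF [x0 Fx0]]]|noF] := pselect (exists F, C F /\ F !=set0); last first.
    left; rewrite -subset0 => x [F CF Fx]; apply: noF.
    by exists F; split=> //; exists x.
  have CP' F' x : C F' -> F' x -> idem_filter F' /\ F0 `<=` F'.
    by move=> /CP[-> //|].
  have [[_ F1 _ _ _] sF0] := CP' _ _ CF Fx0.
  right; split; last by move=> y /sF0; exists F.
  split.
  - by move=> y [F' CF' /[dup] F'y]; have [[+ _ _ _ _] _] := CP' _ _ CF' F'y; apply.
  - by exists F.
  - by move=> [F' CF' F'0]; have [[_ _ + _ _] _] := CP' _ _ CF' F'0.
  - move=> e f [F1' C1 F1e] [F2' C2 F2f].
    have [s12|s21] := totC _ _ C1 C2.
      exists F2' => //; have [[_ _ _ FM _] _] := CP' _ _ C2 F2f.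
      by apply: FM => //; apply: s12.
    exists F1' => //; have [[_ _ _ FM _] _] := CP' _ _ C1 F1e.
    by apply: FM => //; apply: s21.
  - move=> e f [F' CF' F'e] ff ef; exists F' => //.
    by have [[_ _ _ _ +] _] := CP' _ _ CF' F'e; apply; first exact: F'e.
move=> F [FP maxF].
have {FP} [filF sF0] : idem_filter F /\ F0 `<=` F.
  case: FP => // F0E; exfalso; apply: (maxF F0); last by right; split.
  rewrite F0E; split=> // /(_ 1).
  by case: filF0 => _ + _ _ _ => /[swap] /[apply].
exists F => //; split=> // e ee; have [Fid F1 nF0 FM Fup] := filF.
apply: contrapT => /not_orP[nFe nF1e].
(* The filter generated by [F] and [e], where [f * e <= i] for some [f] in [F]. *)
pose F' := [set i | idempotent_elt i /\ exists2 f, F f & f * e * i = f * e].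
apply: (maxF F').
  split=> [i Fi|/(_ e) sF'F]; last first.
    by apply: nFe; apply: sF'F; split=> //; exists 1; rewrite ?mul1r.
  split; first exact: Fid.
  by exists i => //; rewrite -mulrA (R_abelian ee) mulrA (Fid _ Fi).
right; split; last first.
  move=> i /sF0 Fi; split; first exact: Fid.
  by exists i => //; rewrite -mulrA (R_abelian ee) mulrA (Fid _ Fi).
split.
- by move=> i [].
- by split; [exact: idem1|exists 1 => //; rewrite mulr1].
- move=> [_ [f Ff]]; rewrite mulr0 => /esym fe0; apply: nF1e.
  apply: Fup Ff (idemB1 ee) _; by rewrite mulrBr mulr1 fe0 subr0.
- move=> i j [ii [f Ff fi]] [jj [g Fg gj]]; split; first exact: idemM.
  exists (f * g); first exact: FM.
  have gC := R_abelian (Fid _ Fg); have geC := R_abelian (idemM (Fid _ Fg) ee).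
  rewrite -(mulrA f) mulrA -(mulrA f) geC mulrA -(mulrA _ _ j) gj.
  by rewrite -mulrA -geC mulrA [f * _]mulrA -gC -!mulrA [f * _]mulrA fi.
- move=> i j [ii [f Ff fi]] jj ij; split=> //.
  by exists f => //; rewrite -fi -mulrA ij.
Qed.

(** Compactness of the Stone space: if [1] were not good, the complements of the
    good idempotents would form a proper filter, and no idempotent of an
    ultrafilter containing it could be good. *)
Lemma idem_compactness (good : set R) :
    good 0 ->
    (forall e f, good f -> idempotent_elt e -> e * f = e -> good e) ->
    (forall e f, good e -> good f -> idempotent_elt e -> idempotent_elt f ->
      e * f = 0 -> good (e + f)) ->
    (forall F, idem_ultrafilter F -> exists2 e, F e & good e) ->
  good 1.
Proof.
move=> good0 good_down goodD good_loc; apply: contrapT => not_good1.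
have [|F [[Fid F1 F0 FM Fup] ultF] sF] :=
  @idem_filter_ultra [set e | idempotent_elt e /\ good (1 - e)].
- split=> [e [] //||[_]|e f [ee ge] [ff gf]|e f [ee ge] ff ef].
  + by rewrite /= subrr; split=> //; apply: idem1.
  + by rewrite subr0.
  + split; first exact: idemM.
    have -> : 1 - e * f = (1 - e) + e * (1 - f).
      by rewrite mulrBr mulr1 addrA subrK.
    have e1f := idemM ee (idemB1 ff).
    apply: goodD => //; last 2 first.
    * exact: idemB1.
    * by rewrite mulrA mulrBl mul1r ee subrr mul0r.
    by apply: good_down gf _ _ => //; rewrite -mulrA (idemB1 ff).
  + split=> //; apply: good_down ge (idemB1 ff) _.
    rewrite mulrBr mulr1 mulrBl mul1r (R_abelian ff) ef.
    by rewrite subrr subr0.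
have [e Fe ge] := good_loc F (conj (And5 Fid F1 F0 FM Fup) ultF); apply: F0.
have F1e : F (1 - e).
  apply: sF; split; first exact/idemB1/Fid.
  by rewrite opprB addrCA subrr addr0.
by have := FM _ _ Fe F1e; rewrite mulrBr mulr1 (Fid _ Fe) subrr.
Qed.

End Idempotents.
(** * The local stalks of an abelian exchange ring *)

Section Stalk.
Variable R : pzRingType.
Hypothesis R_abelian : abelian_ring R.
Implicit Types (e p q r s : R) (F : set R).

(** Over [e], the element [s * r] is an idempotent, hence central, and a central
    idempotent [i] with [i * (r * s) = e] is [e] itself.  Thus right inverses in
    the stalks are left inverses. *)
Lemma abelian_idem_inv e r s :
  idempotent_elt e -> e * (r * s) = e -> e * (s * r) = e.
Proof.
move=> ee ers; set i := e * (s * r).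
have eC := R_abelian ee.
have ii : idempotent_elt i.
  have -> : idempotent_elt i = (i * i = i) by [].
  rewrite {1}/i eC /i -!mulrA [e * (e * _)]mulrA ee [r * (e * _)]mulrA -eC.
  by rewrite -!mulrA [r * (s * _)]mulrA [e * (_ * r)]mulrA ers mulrA -eC mulrA.
have ei : i * (r * s) = e.
  rewrite mulrA (R_abelian ii) /i !mulrA -eC -!mulrA.
  by rewrite [r * (s * _)]mulrA mulrA ers.
have ie : e * i = i by rewrite /i mulrA ee.
by rewrite -ie eC -ei mulrA ii.
Qed.

(** Invertibility in the stalk at [F]; asking for a right inverse is enough by
    [abelian_idem_inv]. *)
Definition stalk_unit F r : Prop :=
  exists e s, F e /\ e * (r * s) = e.

Variable F : set R.
Hypothesis F_ultra : idem_ultrafilter F.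

Let F_filter : idem_filter F. Proof. by case: F_ultra. Qed.

Let F_idem e : F e -> idempotent_elt e.
Proof. by case: F_filter => + _ _ _ _; apply. Qed.

Definition stalk_max : set R := [set r | ~ stalk_unit F r].

Lemma stalk_unitMl r s : stalk_unit F (r * s) -> stalk_unit F r.
Proof. by move=> [e [t [Fe es]]]; exists e, (s * t); rewrite [r * _]mulrA. Qed.

Lemma stalk_unitMr r s : stalk_unit F (r * s) -> stalk_unit F s.
Proof.
move=> [e [t [Fe es]]]; exists e, (t * r); split=> //.
rewrite [s * _]mulrA; apply: abelian_idem_inv (F_idem Fe) _.
by rewrite [r * _]mulrA.
Qed.

Lemma stalk_max_mull r p : stalk_max p -> stalk_max (r * p).
Proof. by apply: contra_not; apply: stalk_unitMr. Qed.

(** [1 - e] vanishes in the stalk. *)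
Lemma idem_stalk_max e : F e -> stalk_max (1 - e).
Proof.
move=> Fe [i [s [Fi is1]]]; have [_ _ F0 FM _] := F_filter; apply: F0.
suff <- : e * i = 0 by apply: FM.
rewrite -is1 (R_abelian (F_idem Fi)) mulrA mulrA mulrBr mulr1 (F_idem Fe).
by rewrite subrr !mul0r.
Qed.

Hypothesis R_exchange : exchange_ring R.

(** The ultrafilter contains the exchange idempotent [e] in [r R] or the
    idempotent [1 - e] in [(1 - r) R]. *)
Lemma stalk_unit_or r : stalk_unit F r \/ stalk_unit F (1 - r).
Proof.
have [e [ee [s _ rs] [t _ rt]]] := R_exchange r.
have [_ /(_ e ee) [Fe|Fe]] := F_ultra.
  by left; exists e, s; rewrite rs.
by right; exists (1 - e), t; rewrite rt; split=> //; apply: idemB1.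
Qed.

Lemma stalk_unitB1 p : stalk_max p -> stalk_unit F (1 - p).
Proof. by case: (stalk_unit_or p). Qed.

Lemma stalk_max_ideal : right_ideal stalk_max.
Proof.
split.
- move=> [e [s [Fe]]]; rewrite mul0r mulr0 => e0.
  by have [_ _ F0 _ _] := F_filter; apply: F0; rewrite e0.
- move=> p q Pp Pq [e [s [Fe es]]]; apply: Pq.
  have [|i [t [Fi it]]] := @stalk_unitB1 (p * s).
    by move: Pp; apply: contra_not; apply: stalk_unitMl.
  have [_ _ _ FM _] := F_filter.
  exists (i * e), (s * t); split; first exact: FM.
  have eqs : e * (1 - p * s) = e * (q * s).
    by rewrite mulrBr mulr1 -{1}es mulrDl mulrDr addrAC subrr add0r.
  have eC := R_abelian (F_idem Fe).
  rewrite -[i in RHS]it -[RHS]eC [RHS]mulrA (eC i) -[RHS]mulrA.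
  by rewrite [e * (_ * t)]mulrA eqs !mulrA.
- by move=> p r; apply: contra_not; apply: stalk_unitMl.
Qed.
End Stalk.
(** * Finite centralizing extensions *)

Section OneSided.
Variable T : pzRingType.

(** Let [v * u = 1] with [v = a + b x].  The relation [u v + (1 - u v) 1 = 1]
    gives a right invertible [u + (1 - u v) z], and [v] is a left inverse of it
    because [v (1 - u v) = 0].  So [v] is a unit. *)
Lemma stable_range_one_right :
    (forall a b c d : T, a * c + b * d = 1 ->
      exists x y, (a + b * x) * y = 1) ->
  stable_range_one T.
Proof.
move=> sr1 a b abT.
have [_ [c _ <-] [_ [d _ <-] acbd]] :
    [set u + v | u in right_ideal_of a & v in right_ideal_of b] 1 by rewrite abT.
have [x [u vu1]] := sr1 _ _ _ _ acbd; exists x; set v := a + b * x in vu1 *.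
have [|z [w uzw]] := sr1 u (1 - u * v) v 1; first by rewrite mulr1 subrKC.
have vz : v * (u + (1 - u * v) * z) = 1.
  by rewrite mulrDr vu1 mulrA mulrBr mulr1 mulrA vu1 mul1r subrr mul0r addr0.
have vw : v = w by rewrite -[LHS]mulr1 -uzw mulrA vz mul1r.
have uz : u = u + (1 - u * v) * z.
  rewrite -[RHS]mulr1 -[X in _ = _ * X]vu1 mulrA.
  by rewrite [X in _ * X * _]vw uzw mul1r.
by exists u; split=> //; rewrite {1}uz [X in _ * X = _]vw.
Qed.
End OneSided.

Section Extension.
Variables (R T : pzRingType) (f : {rmorphism R -> T}) (gs : seq T).
Hypothesis gs_central : forall g r, g \in gs -> f r * g = g * f r.
Implicit Types (X : set R) (N M : set T) (s : seq T) (g t u w : T).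

Fixpoint lincomb X s : set T :=
  if s is g :: s' then [set t | exists2 r, X r & lincomb X s' (t - g * f r)]
  else [set 0].

Hypothesis gs_span : forall t, lincomb setT gs t.

Section Lincomb.
Variable X : set R.
Hypothesis idX : right_ideal X.

Lemma lincomb0 s : lincomb X s 0.
Proof.
elim: s => //= g s IH; exists 0; first exact: right_ideal0.
by rewrite rmorph0 mulr0 subr0.
Qed.

Lemma lincombD s t u : lincomb X s t -> lincomb X s u -> lincomb X s (t + u).
Proof.
elim: s t u => [|g s IH] t u /=; first by move=> -> ->; rewrite addr0.
move=> [p Xp tp] [q Xq uq]; exists (p + q); first exact: right_idealD.
by rewrite rmorphD mulrDr opprD addrACA; apply: IH.
Qed.

Lemma lincombMr s t r : lincomb X s t -> lincomb X s (t * f r).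
Proof.
elim: s t => [|g s IH] t /=; first by move=> ->; rewrite mul0r.
move=> [p Xp tp]; exists (p * r); first exact: right_idealMr.
by rewrite rmorphM mulrA -mulrBl; apply: IH.
Qed.

Lemma lincombN s t : lincomb X s t -> lincomb X s (- t).
Proof. by rewrite -mulrN1 -(rmorphN1 f); apply: lincombMr. Qed.

Lemma lincomb_ind (K : set T) s :
    K 0 -> (forall t u, K t -> K u -> K (t + u)) ->
    (forall g r, g \in s -> X r -> K (g * f r)) ->
  lincomb X s `<=` K.
Proof.
move=> K0 KD; elim: s => [|g s IH] Kg t /=; first by move=> ->.
move=> [r Xr ts]; rewrite -[t](subrKC (g * f r)).
apply: KD; first by apply: Kg => //; apply: mem_head.
by apply: IH ts => h q sh; apply: Kg; rewrite inE sh orbT.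
Qed.

End Lincomb.

Lemma central_image e : (forall r, e * r = r * e) -> forall t, f e * t = t * f e.
Proof.
move=> eC t.
apply: (lincomb_ind (K := [set t | f e * t = t * f e])) (gs_span t) => /=.
- by rewrite mulr0 mul0r.
- by move=> u w ue we; rewrite mulrDr mulrDl ue we.
- by move=> g r sg _; rewrite mulrA gs_central // -!mulrA -!rmorphM eC.
Qed.

Section Stalk.
Variable F : set R.
Hypothesis R_abelian : abelian_ring R.
Hypothesis R_exchange : exchange_ring R.
Hypothesis F_ultra : idem_ultrafilter F.

Let P := stalk_max F.
Let W := lincomb P gs.
Let P_ideal : right_ideal P. Proof. exact: stalk_max_ideal. Qed.
Let P_mull r p : P p -> P (r * p). Proof. exact: stalk_max_mull. Qed.

Let F_idem e : F e -> idempotent_elt e.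
Proof. by case: F_ultra => [[+ _ _ _ _] _]; apply. Qed.

(** [W] is [T P], a two-sided ideal of [T] since the generators of [T] commute
    with [P]. *)
Lemma ext_ideal_gen t p : P p -> W (t * f p).
Proof.
move=> Pp; rewrite /W; elim: gs t (gs_span t) => [|g s IH] t /=.
  by move=> ->; rewrite mul0r.
move=> [r _ /IH tg]; exists (r * p); first exact: P_mull.
by rewrite rmorphM mulrA -mulrBl.
Qed.

Lemma ext_ideal_mull t w : W w -> W (t * w).
Proof.
apply: (lincomb_ind (K := [set w | W (t * w)])) => /= [|u v Wu Wv|g p _ Pp].
- by rewrite mulr0; apply: lincomb0.
- by rewrite mulrDr; apply: lincombD.
- by rewrite mulrA; apply: ext_ideal_gen.
Qed.

Lemma ext_ideal_right : right_ideal W.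
Proof.
split; [exact: lincomb0|exact: lincombD|].
move=> w t Ww; apply: (lincomb_ind (K := [set t | W (w * t)])) (gs_span t).
- by rewrite /= mulr0; apply: lincomb0.
- by move=> u v /= Wu Wv; rewrite mulrDr; apply: lincombD.
move=> g r sg _ /=; rewrite mulrA; apply: lincombMr => //.
apply: (lincomb_ind (K := [set w | W (w * g)])) Ww => /=.
- by rewrite mul0r; apply: lincomb0.
- by move=> u v Wu Wv; rewrite mulrDl; apply: lincombD.
by move=> h p _ Pp; rewrite -mulrA gs_central // mulrA; apply: ext_ideal_gen.
Qed.

Definition nspan N s : set T := [set t | exists2 n, N n & lincomb setT s (t - n)].

(** The dimension of [N / W] over the division ring [R / P] when [s] is a basis
    of [T / W]: the number of elements of [s] that are leading terms of elements
    of [N]. *)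
Fixpoint rank N s : nat :=
  if s is g :: s' then `[< nspan N s' g >] + rank N s' else 0.

Lemma nspanD N s t u :
  right_ideal N -> nspan N s t -> nspan N s u -> nspan N s (t + u).
Proof.
move=> idN [n Nn tn] [m Nm um]; exists (n + m); first exact: right_idealD.
by rewrite opprD addrACA; apply: lincombD um => //; apply: setT_ideal.
Qed.

Lemma nspanMr N s t r :
  right_ideal N -> nspan N s t -> nspan N s (t * f r).
Proof.
move=> idN [n Nn tn]; exists (n * f r); first exact: right_idealMr.
by rewrite -mulrBl; apply: lincombMr => //; apply: setT_ideal.
Qed.

Lemma nspan_sub N s : right_ideal N -> N `<=` nspan N s.
Proof.
move=> idN t Nt; exists t => //.
by rewrite subrr; apply: lincomb0 (@setT_ideal _) _.
Qed.

(** Gaussian elimination: if [t] in [M] has leading term [g r] and [r] is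
    invertible modulo [P], then [g] is a leading term of [M], hence of [N], and
    can be eliminated from [t] using [N]. *)
Lemma rank_strict N M s :
    right_ideal N -> right_ideal M -> W `<=` N -> N `<=` M ->
  (rank N s <= rank M s)%N /\
    ((rank M s <= rank N s)%N -> M `&` nspan N s `<=` N).
Proof.
move=> idN idM sWN sNM; elim: s => [|g s [le_s IH]] /=.
  by split=> // _ t [_ [n Nn /subr0_eq ->]].
have le_g : (`[< nspan N s g >] <= `[< nspan M s g >])%N.
  by case: asboolP => // -[n Nn gn]; rewrite asboolT //; exists n => //; apply: sNM.
split=> [|le_MN t [Mt [n Nn [r _ tw]]]]; first exact: leq_add.
have le_s' : (rank M s <= rank N s)%N.
  by rewrite -(leq_add2l `[< nspan N s g >]) (leq_trans _ le_MN) // leq_add2r.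
have le_g' : (`[< nspan M s g >] <= `[< nspan N s g >])%N.
  by rewrite -(leq_add2r (rank N s)) (leq_trans _ le_MN) // leq_add2l.
have [Ur|Pr] := pselect (stalk_unit F r); last first.
  apply: (IH le_s'); split=> //; exists (n + g * f r).
    by apply: right_idealD => //; apply/sWN/ext_ideal_gen.
  by rewrite opprD addrA.
have [e [q [Fe eq]]] := Ur.
have Mg : nspan M s g.
  exists ((t - n) * f (q * e) + g * f (1 - e)).
    apply: right_idealD => //.
      by apply/(right_idealMr idM)/(right_idealB idM) => //; apply: sNM.
    by apply/sNM/sWN/ext_ideal_gen/(idem_stalk_max R_abelian F_ultra).
  have gE : g * f r * f (q * e) = g * f e.
    by rewrite -mulrA -rmorphM mulrA -(R_abelian (F_idem Fe)) eq.
  have -> : g - ((t - n) * f (q * e) + g * f (1 - e)) =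
      - ((t - n - g * f r) * f (q * e)).
    rewrite (mulrBl _ (t - n)) gE opprB rmorphB rmorph1 mulrBr mulr1.
    by rewrite opprD opprB addrC -addrA subrK addrC.
  apply: lincombN; first exact: setT_ideal.
  by apply: lincombMr => //; apply: setT_ideal.
have Ng : nspan N s g by move: le_g'; rewrite (asboolT Mg); case: asboolP.
apply: (IH le_s'); split=> //.
rewrite -[t](subrKC n) -(subrKC (g * f r) (t - n)).
apply: nspanD (nspan_sub _ _ _) _ => //.
apply: nspanD => //; first exact: nspanMr.
by exists 0; [apply: right_ideal0 | rewrite subr0].
Qed.

(** The stalk being local, [g = n + g p + w] with [p] in [P] can be solved for
    [g], since [1 - p] is invertible over some [e] in [F] and [g (1 - e)] is in
    [N]: generators are eliminated one by one. *)
Lemma nakayama N s :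
    right_ideal N -> (forall e t, F e -> N (t * f (1 - e))) ->
    (forall t, exists2 n, N n & lincomb P s (t - n)) ->
  forall t, N t.
Proof.
move=> idN NF; elim: s => [|g s IH] sN.
  by move=> t; have [n Nn /subr0_eq ->] := sN t.
apply: IH.
have [n Nn [p Pp gw]] := sN g.
have [e [q [Fe eq]]] : stalk_unit F (1 - p) by apply: stalk_unitB1.
have eC := R_abelian (F_idem Fe).
have [m Nm gm] : exists2 m, N m & lincomb P s (g - m).
  exists (n * f (q * e) + g * f (1 - e)).
    by apply: right_idealD => //; [apply: right_idealMr | apply: NF].
  have -> : g - (n * f (q * e) + g * f (1 - e)) = (g - n - g * f p) * f (q * e).
    have gE : (g - g * f p) * f (q * e) = g * f e.
      rewrite -{1}[g]mulr1 -(rmorph1 f) -mulrBr -rmorphB -mulrA -rmorphM.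
      by rewrite mulrA -eC eq.
    rewrite addrAC mulrBl gE rmorphB rmorph1 mulrBr mulr1.
    by rewrite opprD opprB addrC -addrA subrK addrC.
  exact: lincombMr.
move=> t; have [k Nk [r Pr tw]] := sN t.
exists (k + m * f r); first by apply: right_idealD => //; apply: right_idealMr.
have -> : t - (k + m * f r) = (t - k - g * f r) + (g - m) * f r.
  by rewrite mulrBl addrA subrK opprD addrA.
by apply: lincombD => //; apply: lincombMr.
Qed.

Lemma right_stable_range_stalk a b c d :
    a * c + b * d = 1 ->
  exists x y e, F e /\ ((a + b * x) * y - 1) * f e = 0.
Proof.
move=> abcd.
have [||||x [y Wxy]] := @right_stable_range_mod T W _ _ _ a b c d.
- exact: ext_ideal_right.
- exact: ext_ideal_mull.
- exists (rank^~ gs) => N M idN idM sWN sNM le t Mt.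
  have [_ /(_ le) sub] := rank_strict gs idN idM sWN sNM.
  by apply: sub; split=> //; exists 0; [apply: right_ideal0 | rewrite subr0].
- by rewrite abcd subrr; apply: lincomb0.
have [[Fid F1 F0 FM _] _] := F_ultra.
have fC e : F e -> forall t, f e * t = t * f e.
  by move=> /Fid ee; apply/central_image/(R_abelian ee).
(* The right ideal generated by [a + b x] and by the kernel of the map from [T]
   to its stalk at [F]. *)
pose N := [set t | exists u e, F e /\ (t - (a + b * x) * u) * f e = 0].
suff /(_ 1)[u [e [Fe ue]]] : forall t, N t.
  by exists x, u, e; split=> //; rewrite -opprB mulNr ue oppr0.
apply: (@nakayama N gs).
- split.
  + by exists 0, 1; rewrite mulr0 subrr mul0r.
  + move=> t1 t2 [u1 [e1 [Fe1 te1]]] [u2 [e2 [Fe2 te2]]].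
    exists (u1 + u2), (e1 * e2); split; first exact: FM.
    rewrite mulrDr opprD addrACA mulrDl rmorphM mulrA te1 mul0r add0r.
    by rewrite (fC _ Fe1) mulrA te2 mul0r.
  + move=> t v [u [e [Fe te]]]; exists (u * v), e; split=> //.
    by rewrite mulrA -mulrBl -mulrA -(fC _ Fe) mulrA te mul0r.
- move=> e t Fe; exists 0, e; split=> //.
  rewrite mulr0 subr0 -mulrA -rmorphM mulrBl mul1r (Fid _ Fe).
  by rewrite subrr rmorph0 mulr0.
move=> t; exists ((a + b * x) * y * t).
  by exists (y * t), 1; rewrite mulrA subrr mul0r.
rewrite -[t in t - _]mul1r -mulrBl; apply: right_idealMr ext_ideal_right _ _ _.
by rewrite -opprB; apply: right_idealN ext_ideal_right _ _.
Qed.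

End Stalk.

Theorem finite_centralizing_extension_stable_range_one :
  abelian_ring R -> exchange_ring R -> stable_range_one T.
Proof.
move=> R_abelian R_exchange; apply: stable_range_one_right => a b c d abcd.
pose good := [set e | exists x y, ((a + b * x) * y - 1) * f e = 0].
suff [x [y]] : good 1.
  by rewrite rmorph1 mulr1 => /subr0_eq xy; exists x, y.
apply: (idem_compactness R_abelian).
- by exists 0, 0; rewrite rmorph0 mulr0.
- move=> e i [x [y xy]] ee ei; exists x, y.
  by rewrite -ei (R_abelian _ ee) rmorphM mulrA xy mul0r.
- move=> e i [x1 [y1 xy1]] [x2 [y2 xy2]] ee ii ei.
  have fC j : idempotent_elt j -> forall t, f j * t = t * f j.
    by move=> jj; apply/central_image/(R_abelian _ jj).
  have ie : i * e = 0 by rewrite (R_abelian _ ii).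
  (* Over [e] this is the solution [x1, y1], and over [i] it is [x2, y2]. *)
  exists (x1 * f e + x2 * f i), (y1 * f e + y2 * f i).
  have loc j x y : (forall u, f j * u = u * f j) ->
      (x1 * f e + x2 * f i) * f j = x * f j ->
      (y1 * f e + y2 * f i) * f j = y * f j ->
      ((a + b * x) * y - 1) * f j = 0 ->
    ((a + b * (x1 * f e + x2 * f i)) * (y1 * f e + y2 * f i) - 1) * f j = 0.
    move=> jC xj yj <-; rewrite !mulrBl; congr (_ - _).
    rewrite -!mulrA yj -jC !mulrA; congr (_ * _).
    by rewrite !mulrDl -!mulrA xj.
  have fef r : r * f e * f e = r * f e by rewrite -mulrA -rmorphM ee.
  have fif r : r * f i * f i = r * f i by rewrite -mulrA -rmorphM ii.
  have fei r : r * f e * f i = 0 by rewrite -mulrA -rmorphM ei rmorph0 mulr0.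
  have fie r : r * f i * f e = 0 by rewrite -mulrA -rmorphM ie rmorph0 mulr0.
  rewrite rmorphD mulrDr (loc e _ _ (fC _ ee) _ _ xy1)
    ?(loc i _ _ (fC _ ii) _ _ xy2) ?addr0 //;
    by rewrite mulrDl ?fef ?fif ?fei ?fie ?addr0 ?add0r.
move=> F ultF.
have [x [y [e [Fe xy]]]] :=
  right_stable_range_stalk R_abelian R_exchange ultF abcd.
by exists e => //; exists x, y.
Qed.

End Extension.

(** * Group rings of locally finite groups *)

Lemma generated_subgroup_is_subgroup (G : groupType) (S : set G) :
  is_subgroup (generated_subgroup S).
Proof.
split=> [H [[] //]|g h Sg Sh H SH|g Sg H SH].
- by case: (SH) => -[_ + _] _; apply; [apply: Sg | apply: Sh].
- by case: (SH) => -[_ _ +] _; apply; apply: Sg.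
Qed.

Section Supported.
Variables (R : pzRingType) (G : groupType) (S : set G).
Implicit Types (x y : group_ring R G) (g h : G) (r : R).

Lemma monomialM r s g h :
  (<< r *g g >> : group_ring R G) * (<< s *g h >> : group_ring R G) =
  << r * s *g (g * h)%g >>.
Proof. exact: group_ring_mulUU. Qed.

(** The subring is indexed by a generating set: [generated_subgroup S] is closed
    under products by construction, so that the type below carries a canonical
    ring structure for every [S]. *)
Definition supported : {pred group_ring R G} :=
  fun x => `[< forall g, g \in msupp x -> generated_subgroup S g >].

Lemma supportedP x :
  reflect (forall g, g \in msupp x -> generated_subgroup S g) (x \in supported).
Proof. exact: asboolP. Qed.

Lemma supportedU r g :
  generated_subgroup S g -> (<< r *g g >> : group_ring R G) \in supported.
Proof.
by move=> Sg; apply/supportedP => h /(fsubsetP msuppU_le); rewrite inE => /eqP->.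
Qed.

Lemma supported_subring : subring_closed supported.
Proof.
have [S1 SM _] := generated_subgroup_is_subgroup S.
have supported0 : 0 \in supported by apply/supportedP => g; rewrite msupp0.
have supportedD x y : x \in supported -> y \in supported -> x + y \in supported.
  move=> /supportedP xS /supportedP yS; apply/supportedP => g.
  by move=> /(fsubsetP (msuppD_le _ _)); rewrite inE => /orP[/xS|/yS].
split=> [|x y xS /supportedP yS|x y /supportedP xS /supportedP yS].
- exact: supportedU.
- by apply: supportedD => //; apply/supportedP => g; rewrite msuppN; apply: yS.
have -> : x * y = \sum_(g <- msupp x) \sum_(h <- msupp y)
    (<< x@_g * y@_h *g (g * h)%g >> : group_ring R G) by [].
rewrite big_seq; apply: (big_ind (fun z => z \in supported)) => // g xg.
rewrite big_seq; apply: (big_ind (fun z => z \in supported)) => // h yh.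
by apply: supportedU; apply: SM; [apply: xS | apply: yS].
Qed.

Definition supported_ring : Type := {x : group_ring R G | x \in supported}.

HB.instance Definition _ := SubChoice.on supported_ring.
HB.instance Definition _ := GRing.SubChoice_isSubPzRing.Build
  (group_ring R G) supported supported_ring supported_subring.

Definition supported_monomial r g : supported_ring :=
  insubd (0 : supported_ring) (<< r *g g >> : group_ring R G).

Lemma val_supported_monomial r g :
  generated_subgroup S g ->
  val (supported_monomial r g) = (<< r *g g >> : group_ring R G).
Proof. by move=> Sg; rewrite insubdK //; apply: supportedU. Qed.

Definition supported_scalar r : supported_ring := supported_monomial r 1%g.

Let gen1 : generated_subgroup S 1%g.
Proof. by case: (generated_subgroup_is_subgroup S). Qed.

Lemma supported_scalar_zmod : zmod_morphism supported_scalar.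
Proof.
move=> r s; apply: val_inj; rewrite rmorphB /= !val_supported_monomial //.
exact: monalgUB.
Qed.

Lemma supported_scalar_monoid : monoid_morphism supported_scalar.
Proof.
split=> [|r s]; apply: val_inj;
  rewrite ?rmorph1 ?rmorphM /= !val_supported_monomial //.
by rewrite monomialM mulg1.
Qed.

HB.instance Definition _ :=
  GRing.isZmodMorphism.Build R supported_ring supported_scalar
    supported_scalar_zmod.
HB.instance Definition _ :=
  GRing.isMonoidMorphism.Build R supported_ring supported_scalar
    supported_scalar_monoid.

(** The finitely many group elements in the support subgroup generate the ring
    as a module over the scalars, and they commute with the scalars. *)
Theorem supported_stable_range_one :
    finite_set (generated_subgroup S) -> abelian_ring R -> exchange_ring R ->
  stable_range_one supported_ring.
Proof.
move=> /finite_fsetP[H HE] R_abelian R_exchange.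
have SH g : g \in H -> generated_subgroup S g by rewrite HE.
pose f : {rmorphism R -> supported_ring} := supported_scalar.
apply: (finite_centralizing_extension_stable_range_one (f := f)
  (gs := map (supported_monomial 1) H)) => //.
- move=> _ r /mapP[g /SH Sg ->]; apply: val_inj.
  rewrite !rmorphM /= !val_supported_monomial // !monomialM.
  by rewrite mulr1 mul1r mulg1 mul1g.
move=> t.
have [c] : exists c : G -> R,
    val t = \sum_(g <- H) (<< c g *g g >> : group_ring R G).
  exists (fun g => (val t)@_g); apply: monalgEw; apply/fsubsetP => g tg.
  by have /supportedP/(_ g tg) := valP t; rewrite HE.
have : {subset enum_fset H <= H} by [].
elim: (enum_fset H) t => [|g s IH] t sH /=.
  by rewrite big_nil => t0; apply: val_inj.
rewrite big_cons => tE; exists (c g) => //; apply: IH.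
  by move=> h sh; apply: sH; rewrite inE sh orbT.
have Sg : generated_subgroup S g by apply: SH; apply: sH; rewrite inE eqxx.
rewrite rmorphB rmorphM /= !val_supported_monomial // monomialM mul1r mulg1.
by rewrite tE addrAC subrr add0r.
Qed.

End Supported.

Theorem theorem9 (R : pzRingType) (G : groupType)
    (R_abelian : abelian_ring R) (R_exchange : exchange_ring R)
    (G_locally_finite : locally_finite G) :
  stable_range_one (group_ring R G).
Proof.
apply: stable_range_one_right => a b c d abcd.
pose S : set G :=
  [set g | g \in (msupp a `|` msupp b `|` (msupp c `|` msupp d))%fset].
have finS : finite_set (generated_subgroup S).
  exact/G_locally_finite/finite_fset.
have lift x :
    {subset msupp x <= (msupp a `|` msupp b `|` (msupp c `|` msupp d))%fset} ->
    exists t : supported_ring R S, val t = x.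
  move=> sub; have xS : (x : group_ring R G) \in supported S.
    by apply/supportedP => g /sub gS H [_]; apply.
  by exists (Sub (x : group_ring R G) xS).
have [g|ta taE] := lift a; first by rewrite !inE => ->.
have [g|tb tbE] := lift b; first by rewrite !inE => ->; rewrite !orbT.
have [g|tc tcE] := lift c; first by rewrite !inE => ->; rewrite !orbT.
have [g|td tdE] := lift d; first by rewrite !inE => ->; rewrite !orbT.
have T_sr1 := supported_stable_range_one finS R_abelian R_exchange.
have [|t [u [tu _]]] := T_sr1 ta tb.
  apply/seteqP; split=> // t _.
  exists (ta * (tc * t)); first by exists (tc * t).
  exists (tb * (td * t)); first by exists (td * t).
  rewrite !mulrA -mulrDl; apply: val_inj.
  by rewrite !rmorphM rmorphD !rmorphM /= taE tbE tcE tdE abcd mul1r.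
exists (val t), (val u).
by rewrite -taE -tbE -rmorphM -rmorphD -rmorphM tu rmorph1.
Qed.
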